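(* Consider the system described in the context, with $\theta(z)=z$ and selection policy $\mathbf{P}_{\vec a}$. Assume that for some strictly positive constants $\gamma$ and $\nu$ the weights satisfy: $a_1>0$; the $a_i$'s form an increasing sequence; and $a_i=1-\gamma i^{-\nu}+\mathcal{O}(i^{-\nu-1})$ as $i\to\infty$. Then: - if $\nu>1$, or $\nu=1$ and $\gamma\le1$, the system is always ergodic (i.e. for all values of $\lambda,\alpha,\mu$); - if $\nu<1$, or $\nu=1$ and $\gamma>1$, there is a finite ergodicity bound $M$ (i.e. $M<\infty$) if, and only if, $\sum_{j>0}j^{\nu+1}\varphi_j<\infty$.
   Context: Parameters: $\lambda,\alpha>0$, $\mu>0$; $\{\varphi_k,k\ge1\}$ is a proper probability distribution on the positive integers with generating function $\varphi(z)=\sum_{i\ge1}\varphi_iz^i$, with the standing assumption $\varphi'(1)<\infty$, and $\frac{1-\varphi(z)}{1-z}=\sum_{n\ge0}\Phi_nz^n$ (so $\Phi_n=\sum_{k>n}\varphi_k$). The score of a visited POI increases by exactly one, i.e. $\theta(z)=z$. The dynamical system $\vec r(t)=(r_i(t))_{i\ge1}$ of non-negative sequences is governed by $$\frac{\mathrm{d}r_i(t)}{\mathrm{d}t}=\lambda\varphi_i+\mu\bigl[r_{i+1}(t)-r_i(t)\bigr]+\alpha\bigl[\pi_{i-1}(\vec r(t))-\pi_i(\vec r(t))\bigr],\qquad i\ge1,$$ with $\pi_0(\cdot)=0$. Policy $\mathbf{P}_{\vec a}$: each score $i\ge1$ has a positive weight $a_i$, and $$\pi_i(\vec r)=\frac{a_ir_i}{K},\qquad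 K=\sum_{j\ge1}a_jr_j .$$ A stationary regime $\vec r=(r_i)_{i\ge1}$ satisfies $$r_{n+1}=\frac{\alpha}{\mu K}a_nr_n+\frac{\lambda}{\mu}\Phi_n,\qquad n\ge0$$ (the first term being absent for $n=0$). Ergodicity: the system is called ergodic if it has a finite stationary regime $\vec r$ such that $r(1)=\sum_{i\ge1}r_i<\infty$ and $\overline{\pi}=\sum_{i\ge1}\pi_i(\vec r)=1$ (so in particular with $0<K<\infty$). Ergodicity bound: with $A_n=\prod_{i=1}^na_i$, $A_0=1$, and $F(x)=\sum_{k\ge1}u_kx^k$ where $u_k=\sum_{j\ge0}\frac{A_{j+k}\Phi_j}{A_j}$, put $$M=\lim_{x\to1_-}F(x)=\sum_{k\ge1}\sum_{j\ge0}\frac{A_{j+k}\Phi_j}{A_j}\in(0,\infty].$$ When $M<\infty$ it acts as the limiting value for $\alpha/\lambda$ in the ergodicity condition. *)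

(* Defs.v *)
From HB Require Import structures.
From mathcomp Require Export all_boot all_order all_algebra.
From mathcomp Require Export all_classical all_reals all_analysis.

Export Order.TTheory GRing.Theory Num.Theory.
Export numFieldNormedType.Exports.

Set Implicit Arguments.
Unset Strict Implicit.
Unset Printing Implicit Defensive.

Local Open Scope classical_set_scope.
Local Open Scope ring_scope.
Local Open Scope ereal_scope.

(* Families indexed by the integers i >= 1 are functions on nat whose value at
   0 is never used. Sums of non-negative terms are taken in \bar R, where they
   always exist. *)

Section Distribution.
Context {R : realType}.
Implicit Type phi : nat -> R.

Definition proper_distribution phi : Prop :=
  (forall k, (0 < k)%N -> (0 <= phi k)%R) /\
  \sum_(1 <= k <oo) (phi k)%:E = 1.

(* phi'(1), for the generating function phi(z) of the sequence *)
Definition gf_deriv1 phi : \bar R := \sum_(1 <= k <oo) (k%:R * phi k)%:E.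

(* The coefficient of z^n in (1 - phi(z)) / (1 - z) *)
Definition Phi phi (n : nat) : \bar R := \sum_(n.+1 <= k <oo) (phi k)%:E.

End Distribution.

Section System.
Context {R : realType}.
Implicit Types (lambda alpha mu : R) (phi a r : nat -> R).

Definition total_weight a r : \bar R := \sum_(1 <= j <oo) (a j * r j)%:E.

(* The policy P_a, with pi_0 = 0. When K = total_weight a r is 0 or +oo, all the
   values are 0, hence they do not sum to 1. *)
Definition policy a r (i : nat) : R :=
  if i is 0 then 0%R else (a i * r i / fine (total_weight a r))%R.

(* The right-hand side of the differential system, for theta(z) = z *)
Definition drift lambda alpha mu phi a r (i : nat) : R :=
  (lambda * phi i + mu * (r i.+1 - r i)
   + alpha * (policy a r i.-1 - policy a r i))%R.

Definition stationary lambda alpha mu phi a r : Prop :=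
  (forall i, (0 < i)%N -> (0 <= r i)%R) /\
  (forall i, (0 < i)%N -> drift lambda alpha mu phi a r i = 0%R).

Definition ergodic lambda alpha mu phi a : Prop :=
  exists r, [/\ stationary lambda alpha mu phi a r,
    \sum_(1 <= i <oo) (r i)%:E < +oo &
    \sum_(1 <= i <oo) (policy a r i)%:E = 1].

End System.

Section ErgodicityBound.
Context {R : realType}.
Implicit Types (phi a : nat -> R).

Definition Aprod a (n : nat) : R := (\prod_(1 <= i < n.+1) a i)%R.

Definition u_coef phi a (k : nat) : \bar R :=
  \sum_(0 <= j <oo) (Aprod a (j + k) / Aprod a j)%:E * Phi phi j.

Definition F_series phi a (x : R) : \bar R :=
  \sum_(1 <= k <oo) u_coef phi a k * (x ^+ k)%:E.

Definition ergodicity_bound phi a : \bar R :=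
  lim (F_series phi a x @[x --> 1%R^'-]).

(* F has a limit at 1-, so [lim] above is not a default value. *)
Lemma F_series_cvg phi a :
  proper_distribution phi -> (forall i, (0 < i)%N -> (0 <= a i)%R) ->
  F_series phi a x @[x --> 1%R^'-] --> \sum_(1 <= k <oo) u_coef phi a k.
Proof.
move=> [phi0 _] a0; set S := \sum_(1 <= k <oo) _.
have A0 n : (0 <= Aprod a n)%R.
  rewrite /Aprod big_nat; apply: prodr_ge0 => i /andP[i0 _]; exact: a0.
have Phi0 j : 0 <= Phi phi j.
  apply: nneseries_ge0 => k jk _; rewrite lee_fin; apply: phi0.
  exact: leq_ltn_trans jk.
have u0 k : 0 <= u_coef phi a k.
  apply: nneseries_ge0 => j _ _; apply: mule_ge0 => //.
  by rewrite lee_fin divr_ge0.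
have Fge0 (x : R) k : (0 <= x)%R -> 0 <= u_coef phi a k * (x ^+ k)%:E.
  by move=> x0; apply: mule_ge0 => //; rewrite lee_fin exprn_ge0.
have near0 : \forall x \near 1%R^'-, (0 <= x)%R /\ (x < 1 :> R)%R.
  near=> x; split; last by near: x; exact: nbhs_left_lt.
  by near: x; apply: nbhs_left_ge; exact: ltr01.
have psum n : (\sum_(1 <= k < n) u_coef phi a k * (x ^+ k)%:E)
    @[x --> 1%R^'-] --> \sum_(1 <= k < n) u_coef phi a k.
  apply: cvg_nnesum => k _.
    by near=> x; apply: Fge0; near: x; apply: nbhs_left_ge; exact: ltr01.
  have [->|uNy] := eqVneq (u_coef phi a k) +oo.
    apply: cvg_near_cst; near=> x.
    have x0 : (0 < x)%R by near: x; apply: nbhs_left_gt; exact: ltr01.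
    by rewrite gt0_mulye// lte_fin exprn_gt0.
  have ufin : u_coef phi a k \is a fin_num by rewrite ge0_fin_numE// ltey.
  rewrite -[X in _ --> X]mule1; apply: cvgeZl => //.
  apply: cvg_EFin; first exact: nearW.
  have := @exprn_continuous R k 1%R.
  by move=> /cvg_at_left_filter; rewrite expr1n.
have Fle : \forall x \near 1%R^'-, F_series phi a x <= S.
  near=> x; have [x0 x1] : (0 <= x)%R /\ (x < 1 :> R)%R by near: x.
  apply: lee_nneseries => [k _ _|k _]; first exact: Fge0.
  rewrite -[leRHS]mule1; apply: lee_wpmul2l => //.
  by rewrite lee_fin exprn_ile1// ltW.
have Fgt y : y%:E < S -> \forall x \near 1%R^'-, y%:E < F_series phi a x.
  move=> yS.
  have ndS : nondecreasing_seq (fun n => \sum_(1 <= k < n) u_coef phi a k).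
    by apply: ereal_nondecreasing_series => k _ _; exact: u0.
  have Scvg := ereal_nondecreasing_cvgn ndS.
  move: yS; rewrite /S (cvg_lim _ Scvg)//.
  move=> /ereal_sup_gt[_ [n _ <-]] yn.
  have /(psum n) ynear : nbhs (\sum_(1 <= k < n) u_coef phi a k)
      [set z | y%:E < z].
    by apply: open_nbhs_nbhs; split => //; exact: open_ereal_gt_ereal.
  near=> x; have [x0 x1] : (0 <= x)%R /\ (x < 1 :> R)%R by near: x.
  apply: (@lt_le_trans _ _ (\sum_(1 <= k < n) u_coef phi a k * (x ^+ k)%:E)).
    by near: x.
  by apply: nneseries_lim_ge => k _ _; exact: Fge0.
have S0 : 0 <= S by apply: nneseries_ge0 => k _ _; exact: u0.
have [Sy|SNy] := eqVneq S +oo.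
  by rewrite Sy; apply/cvgeyPgt => y; apply: Fgt; rewrite Sy ltry.
have Sfin : S \is a fin_num by rewrite ge0_fin_numE// ltey.
have Ffin : \forall x \near 1%R^'-, F_series phi a x \is a fin_num.
  near=> x; have [x0 x1] : (0 <= x)%R /\ (x < 1 :> R)%R by near: x.
  have Fx0 : 0 <= F_series phi a x.
    by apply: nneseries_ge0 => k _ _; exact: Fge0.
  rewrite ge0_fin_numE//; apply: (@le_lt_trans _ _ S); last by rewrite ltey.
  by near: x.
rewrite -(fineK Sfin); apply/fine_cvgP; split => //.
apply/cvgrPdist_le => e e0; near=> x.
have Fx : F_series phi a x \is a fin_num by near: x.
have FS : F_series phi a x <= S by near: x.
have eF : (fine S - e)%:E < F_series phi a x.
  by near: x; apply: Fgt; rewrite EFinB fineK// lteBlDr// lteDl// lte_fin.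
rewrite -(fineK Fx) lte_fin in eF.
rewrite ger0_norm ?subr_ge0 ?fine_le//= lerBlDr.
by rewrite -lerBlDl ltW.
Unshelve. all: by end_near. Qed.

Lemma ergodicity_boundE phi a :
  proper_distribution phi -> (forall i, (0 < i)%N -> (0 <= a i)%R) ->
  ergodicity_bound phi a = \sum_(1 <= k <oo) u_coef phi a k.
Proof. by move=> phiP a0; apply/cvg_lim => //; exact: F_series_cvg. Qed.

End ErgodicityBound.

(* Main.v *)
Require Import Defs.
From mathcomp Require Import ring lra.

(** Write [r = (lambda / mu) x], where [x_(n+1) = c a_n x_n + Phi_n] with
    [c = alpha / (mu K)]. Since [a_n <= 1] and [phi'(1) < oo], the total mass
    [X(c)] of [x] is finite and locally Lipschitz on [[0, 1[], and the relation
    defining [c] reads [X(c) = X(0) + alpha / lambda]. By the intermediate value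
    theorem the system is therefore ergodic for all parameters as soon as [X] is
    unbounded, which holds when [\sum_n A_n] diverges because [x_n >= A_(n-1)]
    at [c = 1]. In the first case of the theorem, eventually
    [a_n >= 1 - 1/n - B/n^2], and comparison with [(1 + 2 B / n) / n] gives
    [A_n >= const / n].

    For the second case, exchanging the sums gives [M = \sum_j S_j Phi_j] with
    [S_j = \sum_(k >= 1) A_(j+k) / A_j], and [S_j] is of exact order [j^nu]:
    from below by the geometric series of ratio [a_(j+1)], as the weights are
    increasing; from above because [S_j = a_(j+1) (1 + S_(j+1))] has the
    supersolution [C (j+1)^nu]. Finally [\sum_j (j+1)^nu Phi_j] is comparable
    to [\sum_k k^(nu+1) phi_k]. *)

Set Implicit Arguments.
Unset Strict Implicit.
Unset Printing Implicit Defensive.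

Local Open Scope classical_set_scope.
Local Open Scope ring_scope.

(** * Consequences of the asymptotics of the weights *)

Section Asymptotics.
Context {R : realType}.
Implicit Types (a : nat -> R) (gamma nu B C : R).

Lemma near_powR_ge nu C : 0 < nu -> \forall n \near \oo, C <= n%:R `^ nu.
Proof.
move=> nu0; near=> n.
have C1 : 0 < `|C| + 1 by rewrite ltr_wpDl.
apply: (@le_trans _ _ (`|C| + 1)); first by have := ler_norm C; lra.
have -> : `|C| + 1 = ((`|C| + 1) `^ nu^-1) `^ nu.
  by rewrite -powRrM mulVf ?gt_eqF// powRr1// ltW.
apply: ge0_ler_powR; rewrite ?nnegrE ?powR_ge0//; first exact: ltW.
by near: n; exact: nbhs_infty_ger.
Unshelve. all: by end_near. Qed.

(** The expansion with an explicit constant and without negative exponents, so that [field] and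
    [lra] can work with [n] and [n^nu]. *)
Definition weight_asymptotics a gamma nu B :=
  \forall n \near \oo,
    `|a n - (1 - gamma / n%:R `^ nu)| <= B / (n%:R * n%:R `^ nu).

Lemma bigO_weight_asymptotics a gamma nu :
  a = (fun i : nat => 1 - gamma * i%:R `^ (- nu))
      +O_\oo (fun i : nat => i%:R `^ (- nu - 1)) ->
  exists2 B, 0 < B & weight_asymptotics a gamma nu B.
Proof.
move=> /eqaddOP aO; near (pinfty_nbhs R) => B.
exists B; first by near: B; exact: nbhs_pinfty_gt.
have : \forall n \near \oo,
    `|(a - (fun i : nat => 1 - gamma * i%:R `^ (- nu))) n|
    <= B * `|n%:R `^ (- nu - 1)| by near: B.
apply: filter_app; near=> n.
have n0 : 0 < n%:R :> R by near: n; exact: nbhs_infty_gtr.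
rewrite (ger0_norm (powR_ge0 _ _)) powRB ?(gt_eqF n0) ?implybT//.
by rewrite powRr1 ?(ltW n0)// invfM [_^-1 * _^-1]mulrC -powRN.
Unshelve. all: by end_near. Qed.

(** By monotonicity only large indices matter, and for [n > B / gamma] the error term is smaller
    than [gamma / n^nu]. *)
Lemma weights_lt1 a gamma nu B :
  (forall i j : nat, (0 < i)%N -> (i <= j)%N -> a i <= a j) ->
  0 < gamma -> 0 < B -> weight_asymptotics a gamma nu B ->
  forall i, (0 < i)%N -> a i < 1.
Proof.
move=> ainc g0 B0 aP i i0; near \oo => n.
apply: (@le_lt_trans _ _ (a n)).
  by apply: ainc => //; near: n; exact: nbhs_infty_ge.
have n0 : 0 < n%:R :> R by near: n; exact: nbhs_infty_gtr.
have p0 : 0 < n%:R `^ nu :> R by exact: powR_gt0.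
have : `|a n - (1 - gamma / n%:R `^ nu)| <= B / (n%:R * n%:R `^ nu).
  by near: n.
have Bn : B / gamma < n%:R by near: n; exact: nbhs_infty_gtr.
move=> /ler_normlP[_]; apply: contraTlt => an1; rewrite -ltNge.
have : B / (n%:R * n%:R `^ nu) < gamma / n%:R `^ nu.
  by rewrite invfM mulrA ltr_pM2r ?invr_gt0// ltr_pdivrMr// mulrC -ltr_pdivrMr.
lra.
Unshelve. all: by end_near. Qed.

(** Write [n^nu = n q] with [q = n^(nu - 1)]. Eventually [q >= gamma] and [q >= 1], since [q] tends
    to infinity for [nu > 1] and equals 1 for [nu = 1]. *)
Lemma weights_ge a gamma nu B : 0 < gamma -> 0 < B ->
  1 < nu \/ nu = 1 /\ gamma <= 1 -> weight_asymptotics a gamma nu B ->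
  \forall n \near \oo, 1 - n%:R^-1 - B / n%:R ^+ 2 <= a n.
Proof.
move=> g0 B0 nuP aP.
have qP : \forall n \near \oo,
    gamma <= n%:R `^ (nu - 1) :> R /\ 1 <= n%:R `^ (nu - 1) :> R.
  case: nuP => [nu1|[-> g1]]; near=> n; last by rewrite subrr powRr0.
  by split; near: n; apply: near_powR_ge; rewrite subr_gt0.
near=> n.
have n0 : 0 < n%:R :> R by near: n; exact: nbhs_infty_gtr.
have n1 : 1 <= n%:R :> R by apply: ltW; near: n; exact: nbhs_infty_gtr.
have p0 : 0 < n%:R `^ nu :> R by exact: powR_gt0.
have : `|a n - (1 - gamma / n%:R `^ nu)| <= B / (n%:R * n%:R `^ nu).
  by near: n.
move=> /ler_normlP[+ _].
have q0 : 0 < n%:R `^ (nu - 1) :> R by exact: powR_gt0.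
have -> : n%:R `^ nu = n%:R * n%:R `^ (nu - 1) :> R.
  by rewrite -{2}[n%:R]powRr1 ?(ltW n0)// -powRD ?subrKC// (gt_eqF n0) implybT.
suff : gamma / (n%:R * n%:R `^ (nu - 1))
    + B / (n%:R * (n%:R * n%:R `^ (nu - 1)))
    <= n%:R^-1 + B / n%:R ^+ 2 by lra.
set q := n%:R `^ (nu - 1) in q0 *.
have [gq q1] : gamma <= q /\ 1 <= q by rewrite /q; near: n.
apply: lerD.
  by rewrite invfM mulrCA ler_piMr ?invr_ge0 ?(ltW n0)// ler_pdivrMr// mul1r.
rewrite ler_pM2l// lef_pV2 ?posrE ?mulr_gt0 ?exprn_gt0// expr2 ler_pM2l//.
by rewrite ler_peMr// ltW.
Unshelve. all: by end_near. Qed.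

Lemma powR_succ_le nu (x : R) : 0 < x -> nu <= 1 ->
  (x + 1) `^ nu <= x `^ nu * (1 + x^-1).
Proof.
move=> x0 nu1; have -> : x + 1 = x * (1 + x^-1).
  by rewrite mulrDr mulr1 divff ?gt_eqF.
have x1 : 1 <= 1 + x^-1 by rewrite lerDl invr_ge0 ltW.
rewrite powRM ?(ltW x0) ?(le_trans _ x1)// ler_pM2l ?powR_gt0//.
exact: ler1_powR.
Qed.

(** With [C = 1 / (gamma - d)] and [p = n^nu], dividing by [C] leaves
    [a_n (gamma - d + (n+1)^nu) <= p]. Since [(n+1)^nu <= p + p/n] and [a_n p <= p - gamma + B/n],
    it suffices that [(p + B)/n <= d]. The left side tends to 0 if [nu < 1] and to 1 if [nu = 1], so
    some [d < gamma] works. *)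
Lemma powR_supersolution a gamma nu B : 0 < gamma -> 0 < nu -> 0 < B ->
  nu < 1 \/ nu = 1 /\ 1 < gamma -> (forall i, (0 < i)%N -> 0 < a i < 1) ->
  weight_asymptotics a gamma nu B ->
  exists2 C, 0 < C & \forall n \near \oo,
    a n * (1 + C * n.+1%:R `^ nu) <= C * n%:R `^ nu.
Proof.
move=> g0 nu0 B0 nuP alt1 aP.
have [d dg dP] : exists2 d, d < gamma &
    \forall n \near \oo, (n%:R `^ nu + B) / n%:R <= d.
  case: nuP => [nu1|[nu1 g1]].
    exists (gamma / 2); first lra.
    near=> n.
    have n0 : 0 < n%:R :> R by near: n; exact: nbhs_infty_gtr.
    have nB : 4 * B / gamma < n%:R by near: n; exact: nbhs_infty_gtr.
    have : 4 / gamma <= n%:R `^ (1 - nu).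
      by near: n; apply: near_powR_ge; rewrite subr_gt0.
    rewrite powRB ?(gt_eqF n0) ?implybT// powRr1 ?(ltW n0)//.
    have p0 : 0 < n%:R `^ nu :> R by exact: powR_gt0.
    rewrite ler_pdivlMr// mulrAC ler_pdivrMr// => pn.
    move: nB; rewrite ltr_pdivrMr// => nB; rewrite ler_pdivrMr//; lra.
  exists ((1 + gamma) / 2); first lra.
  near=> n.
  have n0 : 0 < n%:R :> R by near: n; exact: nbhs_infty_gtr.
  have : 2 * B / (gamma - 1) < n%:R by near: n; exact: nbhs_infty_gtr.
  rewrite nu1 powRr1 ?(ltW n0)// ltr_pdivrMr ?subr_gt0// ler_pdivrMr//; lra.
exists (gamma - d)^-1; first by rewrite invr_gt0 subr_gt0.
near=> n.
have n0 : 0 < n%:R :> R by near: n; exact: nbhs_infty_gtr.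
have p0 : 0 < n%:R `^ nu :> R by exact: powR_gt0.
have : `|a n - (1 - gamma / n%:R `^ nu)| <= B / (n%:R * n%:R `^ nu).
  by near: n.
have nd : (n%:R `^ nu + B) / n%:R <= d by near: n.
have /andP[/ltW a0 an1] : 0 < a n < 1 by apply: alt1; rewrite -(ltr0n R).
move=> /ler_normlP[_ aub].
have np : n.+1%:R `^ nu <= n%:R `^ nu * (1 + n%:R^-1) :> R.
  by rewrite -natr1; apply: powR_succ_le => //; case: nuP => [|[->]]//; exact: ltW.
have gd : 0 < gamma - d by rewrite subr_gt0.
rewrite -(ler_pM2l gd) mulVKf ?gt_eqF// mulrCA mulrDr mulr1 mulVKf ?gt_eqF//.
set x : R := n%:R in n0 p0 nd aub np *; set p := x `^ nu in p0 nd aub np *.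
apply: (@le_trans _ _ (a n * (gamma - d + p * (1 + x^-1)))).
  by rewrite ler_wpM2l// lerD2l.
have : a n * (gamma - d + p * x^-1) <= gamma - d + p * x^-1.
  by rewrite ler_piMl ?ltW// addr_gt0 ?mulr_gt0 ?invr_gt0.
have : a n * p <= p - gamma + B / x.
  have -> : p - gamma + B / x = (1 - gamma / p + B / (x * p)) * p.
    by field; rewrite !gt_eqF.
  by rewrite ler_pM2r//; lra.
move: nd; lra.
Unshelve. all: by end_near. Qed.

End Asymptotics.

(** * Divergence of the series of [A_n] *)

Section Aprod_series.
Context {R : realType}.
Implicit Types (a : nat -> R) (B C : R).

Lemma AprodS a n : Aprod a n.+1 = Aprod a n * a n.+1.
Proof. by rewrite /Aprod big_nat_recr. Qed.

Lemma Aprod_gt0 a n : (forall i, (0 < i)%N -> 0 < a i) -> 0 < Aprod a n.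
Proof.
move=> a0; rewrite /Aprod big_nat; apply: prodr_gt0 => i /andP[i0 _].
exact: a0.
Qed.

Lemma harmonic_series_unbounded C : exists N, C < series (@harmonic R) N.
Proof.
apply: contrapT => /forallNP hC; apply: (@dvg_harmonic R).
apply: nondecreasing_is_cvgn.
  by apply: nondecreasing_series => n _ _; exact: harmonic_ge0.
by exists C => _ [n _ <-]; rewrite leNgt; apply/negP.
Qed.

(* [c (1 + 2 B / n) / n] is a subsolution of the recurrence of [Aprod a]. *)
Lemma Aprod_ge_harmonic a B : (forall i, (0 < i)%N -> 0 < a i) -> 0 < B ->
  (\forall n \near \oo, 1 - n%:R^-1 - B / n%:R ^+ 2 <= a n) ->
  exists c N, [/\ 0 < c, (0 < N)%N &
    forall k, c / (N + k)%:R <= Aprod a (N + k)].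
Proof.
move=> a0 B0 [N1 _ aP].
(* The subsolution inequality for [w] holds from [2 B] on: its defect at [x] is a positive multiple
   of [x - 2 B]. *)
have [N [N0 NN1 NB]] : exists N, [/\ (0 < N)%N, (N1 <= N)%N & 2 * B <= N%:R].
  near \oo => N; exists N; split; near: N.
  - exact: nbhs_infty_gt.
  - exact: nbhs_infty_ge.
  - exact: nbhs_infty_ger.
pose w n : R := (1 + 2 * B / n%:R) / n%:R.
have w_gt0 n : (0 < n)%N -> 0 < w n.
  by move=> n0; rewrite !(divr_gt0, addr_gt0, mulr_gt0) ?ltr0n.
have NR : 0 < N%:R :> R by rewrite ltr0n.
(* This scaling makes the induction start with equality at [N]. *)
pose c := Aprod a N / w N.
have c0 : 0 < c by rewrite divr_gt0 ?Aprod_gt0 ?w_gt0.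
exists c, N; split => // k.
apply: (@le_trans _ _ (c * w (N + k)%N)).
  have Nk : 0 < (N + k)%:R :> R by rewrite ltr0n addn_gt0 N0.
  rewrite ler_pM2l// ler_peMl ?invr_ge0 ?(ltW Nk)// lerDl divr_ge0 ?(ltW Nk)//.
  by rewrite mulr_ge0 ?ltW.
elim: k => [|k ih]; first by rewrite addn0 /c divfK ?gt_eqF ?w_gt0.
rewrite addnS AprodS; set m := (N + k)%N in ih *.
have m0 : (0 < m)%N by rewrite addn_gt0 N0.
apply: (@le_trans _ _ (c * w m * a m.+1)); last by rewrite ler_pM2r ?a0.
rewrite -mulrA ler_pM2l//.
have am : 1 - m.+1%:R^-1 - B / m.+1%:R ^+ 2 <= a m.+1.
  by apply: aP => /=; rewrite (leq_trans NN1)// ltnW// ltnS leq_addr.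
apply: (le_trans _ (ler_wpM2l (ltW (w_gt0 _ m0)) am)).
have mB : 2 * B <= m%:R by rewrite (le_trans NB)// ler_nat leq_addr.
have mR : 0 < m%:R :> R by rewrite ltr0n.
rewrite /w -[m.+1%:R]natr1; move: (m%:R : R) mB mR => x xB x0.
have x1 : 0 < x + 1 by rewrite addr_gt0.
rewrite -subr_ge0.
have -> : (1 + 2 * B / x) / x * (1 - (x + 1)^-1 - B / (x + 1) ^+ 2)
    - (1 + 2 * B / (x + 1)) / (x + 1) = B * (x - 2 * B) / (x * (x + 1)) ^+ 2.
  by field; rewrite !gt_eqF.
by rewrite divr_ge0 ?exprn_ge0 ?mulr_ge0 ?subr_ge0// ltW.
Unshelve. all: by end_near. Qed.

Lemma Aprod_series_unbounded a B C :
  (forall i, (0 < i)%N -> 0 < a i) -> 0 < B ->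
  (\forall n \near \oo, 1 - n%:R^-1 - B / n%:R ^+ 2 <= a n) ->
  exists N, C < series (Aprod a) N.
Proof.
move=> a0 B0 aP; have [c [N [c0 N0 cP]]] := Aprod_ge_harmonic a0 B0 aP.
have NR : 0 < N%:R :> R by rewrite ltr0n.
(* As [N + k <= N (k+1)], each term [c / (N + k)] is at least [c / N] times the harmonic term of
   index [k]. *)
have [K CK] := harmonic_series_unbounded (C / (c / N%:R)).
exists (N + K)%N; move: CK; rewrite ltr_pdivrMr ?divr_gt0// => /lt_le_trans.
apply; rewrite !seriesEnat /= (big_cat_nat (leq0n N) (leq_addr K N))/=.
rewrite ler_wpDl//; first by apply: sumr_ge0 => i _; apply/ltW/Aprod_gt0.
rewrite -{2}[N]add0n big_addn addKn mulr_suml; apply: ler_sum => k _.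
rewrite addnC; apply: le_trans (cP k); rewrite mulrC -mulrA ler_pM2l//.
rewrite /harmonic -invfM lef_pV2 ?posrE ?mulr_gt0 ?ltr0n ?addn_gt0 ?N0//.
by rewrite -natrM ler_nat mulnS leq_add2l leq_pmull.
Qed.

End Aprod_series.

(** * Existence of the stationary regime *)

Section Regime.
Context {R : realType}.
Variables (a f : nat -> R) (U : R).
Hypothesis a01 : forall i, (0 < i)%N -> 0 < a i < 1.
Hypothesis f_ge0 : forall n, 0 <= f n.
Hypothesis fU : series f @ \oo --> U.

(* The stationary recurrence with [c] for [alpha / (mu K)], normalized by
   [lambda / mu = 1]. *)
Fixpoint regime (c : R) n : R :=
  if n is m.+1 then c * (a m * regime c m) + f m else 0.

Lemma regimeS c n : regime c n.+1 = c * (a n * regime c n) + f n.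
Proof. by []. Qed.

Lemma series_le_lim (u : nat -> R) (l : R) N : (forall n, 0 <= u n) ->
  series u @ \oo --> l -> series u N <= l.
Proof.
move=> u0 ul; rewrite -(cvg_lim _ ul)//; apply: nondecreasing_cvgn_le.
  by apply: nondecreasing_series => n _ _.
by apply/cvg_ex; exists l.
Qed.

Lemma regime_ge0 c n : 0 <= c -> 0 <= regime c n.
Proof.
move=> c0; elim: n => [//|[|n] ih] /=; first by rewrite !mulr0 add0r.
by rewrite addr_ge0// mulr_ge0// mulr_ge0//; have /andP[/ltW] := a01 (ltn0Sn n).
Qed.

Lemma wregime_ge0 c n : 0 <= c -> 0 <= a n * regime c n.
Proof.
(* Nothing is known of [a 0], but it only ever multiplies [regime c 0 = 0]. *)
case: n => [|n] c0; first by rewrite mulr0.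
by rewrite mulr_ge0 ?regime_ge0//; have /andP[/ltW] := a01 (ltn0Sn n).
Qed.

Lemma wregime_le c n : 0 <= c -> a n * regime c n <= regime c n.
Proof.
case: n => [|n] c0; first by rewrite mulr0.
by rewrite ler_piMl ?regime_ge0//; have /andP[_ /ltW] := a01 (ltn0Sn n).
Qed.

Lemma seriesS_recl (u : nat -> R) N : u 0%N = 0 ->
  series u N.+1 = \sum_(0 <= n < N) u n.+1.
Proof. by move=> u0; rewrite seriesEnat /= big_nat_recl// u0 add0r. Qed.

Lemma regime_seriesS c N : series (regime c) N.+1 =
  c * series (fun n => a n * regime c n) N + series f N.
Proof. by rewrite seriesS_recl// big_split/= -mulr_sumr. Qed.

(** Summing the recurrence with [a_n <= 1] gives [S_N <= S_(N+1) <= c S_N + U] for the partial sums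
    [S_N]. *)
Lemma regime_series_le c N : 0 <= c < 1 -> series (regime c) N <= U / (1 - c).
Proof.
move=> /andP[c0 c1]; rewrite ler_pdivlMr ?subr_gt0//.
have SS : series (regime c) N <= series (regime c) N.+1.
  by rewrite seriesSr lerDl regime_ge0.
have : series (fun n => a n * regime c n) N <= series (regime c) N.
  by apply: ler_sum => i _; exact: wregime_le.
rewrite regime_seriesS in SS.
move=> /(ler_wpM2l c0); have := series_le_lim N f_ge0 fU; lra.
Qed.

Lemma regime_series_cvg c : 0 <= c < 1 -> cvgn (series (regime c)).
Proof.
move=> c01; have /andP[c0 _] := c01; apply: nondecreasing_is_cvgn.
  by apply: nondecreasing_series => n _ _; exact: regime_ge0.
by exists (U / (1 - c)) => _ [n _ <-]; exact: regime_series_le.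
Qed.

Definition regime_total c := limn (series (regime c)).

Lemma regime_total_ge c N : 0 <= c < 1 ->
  series (regime c) N <= regime_total c.
Proof.
move=> c01; have /andP[c0 _] := c01.
apply: series_le_lim => [n|]; [exact: regime_ge0|exact: regime_series_cvg].
Qed.

Lemma regime_total0 : regime_total 0 = U.
Proof.
apply/cvg_lim => //; rewrite -cvg_shiftS /=.
have -> : (fun n => series (regime 0) n.+1) = series f; last exact: fU.
by apply/funext => n; rewrite regime_seriesS mul0r add0r.
Qed.

Lemma regime_nondecreasing x y n : 0 <= x <= y -> regime x n <= regime y n.
Proof.
move=> /andP[x0 xy]; elim: n => [//|n ih]; rewrite !regimeS lerD2r.
apply: ler_pM => //; first exact: wregime_ge0.
case: n ih => [|n] ih; first by rewrite !mulr0.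
by rewrite ler_wpM2l//; have /andP[/ltW] := a01 (ltn0Sn n).
Qed.

(** The difference [D] of the two regimes obeys the same recurrence with parameter [y] and source
    [(y - x) a_n regime x n]. The source sums to at most [(y - x) U / (1 - y)], and the recurrence
    costs one more factor [1 / (1 - y)]. *)
Lemma regime_series_lipschitz x y N : 0 <= x <= y -> y < 1 ->
  series (regime y) N - series (regime x) N <= (y - x) * (U / (1 - y) ^+ 2).
Proof.
move=> /andP[x0 xy] y1.
pose D n := regime y n - regime x n.
have D0 n : 0 <= D n by rewrite subr_ge0 regime_nondecreasing// x0.
have DE M : series D M = series (regime y) M - series (regime x) M.
  by rewrite /series/= sumrB.
have DS M : series D M.+1 <= y * series D M + (y - x) * series (regime x) M.
  rewrite seriesS_recl; last by rewrite /D subrr.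
  rewrite /series/= !mulr_sumr -big_split/=; apply: ler_sum => n _.
  have -> : D n.+1 = y * (a n * D n) + (y - x) * (a n * regime x n).
    by rewrite /D /=; ring.
  apply: lerD; apply: ler_wpM2l; rewrite ?subr_ge0//.
  - exact: le_trans xy.
  - case: n => [|n]; first by rewrite /D subrr mulr0.
    by rewrite ler_piMl//; have /andP[_ /ltW] := a01 (ltn0Sn n).
  - exact: wregime_le.
have SD : series D N <= series D N.+1 by rewrite seriesSr lerDl.
have U0 : 0 <= U.
  by have := series_le_lim 0 f_ge0 fU; rewrite /series/= big_geq.
have Sx : series (regime x) N <= U / (1 - y).
  apply: le_trans (regime_series_le N _) _; first by rewrite x0 (le_lt_trans xy).
  by rewrite ler_wpM2l// lef_pV2 ?posrE ?subr_gt0 ?(le_lt_trans xy)// lerB.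
rewrite -DE.
have -> : (y - x) * (U / (1 - y) ^+ 2) = (y - x) * (U / (1 - y)) / (1 - y).
  by field; rewrite subr_eq0 gt_eqF.
rewrite ler_pdivlMr ?subr_gt0// mulrBr mulr1 [_ * y]mulrC.
have yx : 0 <= y - x by rewrite subr_ge0.
have := DS N; have := ler_wpM2l yx Sx; lra.
Qed.

Lemma regime_total_lipschitz x y : 0 <= x <= y -> y < 1 ->
  0 <= regime_total y - regime_total x <= (y - x) * (U / (1 - y) ^+ 2).
Proof.
move=> xy y1; have /andP[x0 lexy] := xy.
have cx := @regime_series_cvg x; have cy := @regime_series_cvg y.
rewrite x0 (le_lt_trans lexy)//= in cx; rewrite y1 (le_trans x0)//= in cy.
move: (cx isT) (cy isT) => {}cx {}cy.
rewrite /regime_total -limB//; apply/andP; split.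
  apply: limr_ge; first exact: is_cvgB.
  apply: nearW => N; rewrite /= subr_ge0; apply: ler_sum => n _.
  exact: regime_nondecreasing.
apply: limr_le; first exact: is_cvgB.
by apply: nearW => N; exact: regime_series_lipschitz.
Qed.

Lemma regime_total_within_continuous b : b < 1 ->
  {within `[0, b], continuous regime_total}.
Proof.
move=> b1; have b10 : 0 < 1 - b by rewrite subr_gt0.
have U0 : 0 <= U.
  by have := series_le_lim 0 f_ge0 fU; rewrite /series/= big_geq.
(* A Lipschitz constant valid on all of [[0, b]]; the added 1 makes it positive, so that [e / L]
   makes sense. *)
pose L := U / (1 - b) ^+ 2 + 1.
have L0 : 0 < L by rewrite ltr_wpDl// divr_ge0// exprn_ge0// ltW.
have lip x y : 0 <= x -> x <= y -> y <= b ->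
    `|regime_total x - regime_total y| <= (y - x) * L.
  move=> x0 xy yb; have y1 := le_lt_trans yb b1.
  have /andP[d0 dle] : 0 <= regime_total y - regime_total x
      <= (y - x) * (U / (1 - y) ^+ 2).
    by apply: regime_total_lipschitz; rewrite ?x0.
  rewrite distrC ger0_norm//; apply: (le_trans dle).
  rewrite ler_wpM2l ?subr_ge0// ler_wpDr// ler_wpM2l//.
  have ? : 0 < 1 - y by rewrite subr_gt0.
  rewrite lef_pV2 ?posrE ?exprn_gt0// lerXn2r ?nnegrE ?(ltW b10)//; first exact: ltW.
  by rewrite lerB.
apply/subspace_continuousP => x; rewrite /= in_itv/= => /andP[x0 xb].
apply/cvgrPdist_le => e e0; rewrite near_withinE.
have /cvgr_dist_le/(_ _ (divr_gt0 e0 L0)) := @cvg_id _ (nbhs x).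
apply: filterS => y xye /=; rewrite in_itv/= => /andP[y0 yb].
have xyL : `|x - y| * L <= e by rewrite -ler_pdivlMr.
apply: le_trans xyL; have [xy|/ltW yx] := leP x y.
  by rewrite [leRHS](_ : _ = (y - x) * L) ?lip// distrC ger0_norm ?subr_ge0.
by rewrite [leRHS](_ : _ = (x - y) * L) 1?distrC ?lip// distrC ger0_norm ?subr_ge0.
Qed.

Lemma regime_continuous n : continuous (fun c => regime c n).
Proof.
elim: n => [|n ih] x /=; first exact: cvg_cst.
apply: cvgD; last exact: cvg_cst.
by apply: cvgM; [exact: cvg_id|apply: cvgM; [exact: cvg_cst|exact: ih]].
Qed.

(** Dropping every source term except [f 0] leaves the pure product. *)
Lemma regime1_ge_Aprod n : f 0%N * Aprod a n <= regime 1 n.+1.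
Proof.
elim: n => [|n ih].
  by rewrite /Aprod big_geq//= mulr0 mulr0 add0r mulr1.
rewrite AprodS mulrA regimeS mul1r.
rewrite ler_wpDr// mulrC ler_wpM2l//.
by have /andP[/ltW] := a01 (ltn0Sn n).
Qed.

(** Some partial sum at [c = 1] exceeds [v]. Being continuous in [c], it still does for some
    [c < 1], where it is a lower bound of the convergent total. *)
Lemma regime_total_unbounded v : 0 < f 0%N ->
  (forall C, exists N, C < series (Aprod a) N) ->
  exists2 c, 0 <= c < 1 & v < regime_total c.
Proof.
move=> f0 Aub; have [N vN] := Aub (v / f 0%N).
have v1 : v < series (regime 1) N.+1.
  move: vN; rewrite ltr_pdivrMr// => /lt_le_trans; apply.
  rewrite seriesS_recl// /series/= mulrC mulr_sumr.
  by apply: ler_sum => n _; exact: regime1_ge_Aprod.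
have cts : series (regime c) N.+1 @[c --> (1 : R)] --> series (regime 1) N.+1.
  by apply: cvg_big => [|n _]; [exact: add_continuous|exact: regime_continuous].
have near1 : \forall c \near 1^'-, v < series (regime c) N.+1.
  move/cvg_at_left_filter : cts => cts.
  exact: (cvgr_gt (series (regime 1) N.+1)).
near (1 : R)^'- => c.
have c01 : 0 <= c < 1.
  by apply/andP; split; near: c; [exact: nbhs_left_ge|exact: nbhs_left_lt].
exists c => //; apply: lt_le_trans (regime_total_ge N.+1 c01).
by near: c.
Unshelve. all: by end_near. Qed.

Lemma regime_total_surj v : U < v -> 0 < f 0%N ->
  (forall C, exists N, C < series (Aprod a) N) ->
  exists2 c, 0 < c < 1 & regime_total c = v.
Proof.
move=> Uv f0 Aub; have [b /andP[b0 b1] vb] := regime_total_unbounded v f0 Aub.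
have [|c] := @IVT R regime_total 0 b v b0 (regime_total_within_continuous b1).
  by rewrite regime_total0 ge_min le_max !(ltW Uv) (ltW vb) orbT.
rewrite in_itv/= => /andP[c0 cb] cv; exists c => //.
(* The case [c = 0] is excluded because the total there is [U < v]. *)
rewrite (le_lt_trans cb b1) andbT lt_neqAle c0 andbT.
by apply: contraTneq Uv => c0'; rewrite -cv -c0' regime_total0 ltxx.
Qed.

(** The summed recurrence reads [X(c) = c W + U], where [W] is the weighted total; this is solved
    for [W]. *)
Lemma wregime_series_cvg c : 0 < c < 1 ->
  series (fun n => a n * regime c n) @ \oo --> (regime_total c - U) / c.
Proof.
move=> /andP[c0 c1].
have -> : series (fun n => a n * regime c n) =
    (fun N => (series (regime c) N.+1 - series f N) / c).
  apply/funext => N; rewrite regime_seriesS addrK mulrAC mulfV ?mul1r//.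
  by rewrite gt_eqF.
apply: cvgMl; apply: cvgB => //; rewrite cvg_shiftS.
by apply: regime_series_cvg; rewrite ltW.
Qed.

End Regime.

(** * Tails of the distribution and their weighted sums *)

Section Tails.
Context {R : realType}.
Variable phi : nat -> R.
Hypothesis phi_distr : proper_distribution phi.

Let phi_ge0 k : (0 < k)%N -> 0 <= phi k.
Proof. by case: phi_distr => + _; exact. Qed.

Lemma Phi_ge0 n : (0 <= Phi phi n)%E.
Proof.
by apply: nneseries_ge0 => k nk _; rewrite lee_fin phi_ge0// (leq_ltn_trans _ nk).
Qed.

Lemma Phi0 : Phi phi 0 = 1%E.
Proof. by case: phi_distr. Qed.

Lemma PhiS n : Phi phi n = ((phi n.+1)%:E + Phi phi n.+1)%E.
Proof.
rewrite /Phi (@nneseries_split _ _ n.+1 1); last first.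
  by move=> k nk; rewrite lee_fin phi_ge0// (leq_trans _ nk).
by rewrite addn1 big_nat1.
Qed.

Lemma Phi_fin n : Phi phi n \is a fin_num.
Proof.
elim: n => [|n]; first by rewrite Phi0.
by rewrite PhiS fin_numD => /andP[].
Qed.

(** Tonelli: both sides sum [w j * phi k] over the pairs [j < k]. Constant weights give the mean,
    powers give higher moments. *)
Lemma Phi_weighted_sum (w : nat -> R) : (forall j, 0 <= w j) ->
  (\sum_(0 <= j <oo) (w j)%:E * Phi phi j =
   \sum_(1 <= k <oo) ((\sum_(0 <= j < k) w j) * phi k)%:E)%E.
Proof.
move=> w0.
(* Padding by zeros makes both ranges independent; [phi 0] is never read, since no [j] is below
   0. *)
pose b j k : \bar R := if (j < k)%N then (w j * phi k)%:E else 0%E.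
have b0 j k : (0 <= b j k)%E.
  rewrite /b; case: ifP => // jk; rewrite lee_fin mulr_ge0// phi_ge0//.
  exact: leq_ltn_trans jk.
transitivity (\sum_(0 <= j <oo) \sum_(0 <= k <oo) b j k)%E.
  apply: eq_eseriesr => j _; rewrite /Phi eseries_cond/= -nneseriesZl.
    by rewrite eseries_mkcond.
  by move=> k jk; rewrite lee_fin phi_ge0// (leq_ltn_trans _ jk).
rewrite nneseries_interchange// [RHS]eseries_cond [RHS]eseries_mkcond.
apply: eq_eseriesr => k _.
have -> : (\sum_(0 <= j <oo) b j k = ((\sum_(0 <= j < k) w j) * phi k)%:E)%E.
  rewrite (@nneseries_split _ _ 0 k)// add0n [X in (_ + X)%E]eseries0 ?adde0.
    rewrite mulr_suml -sumEFin; apply: eq_big_nat => j /andP[_ jk].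
    by rewrite /b jk.
  by move=> j kj _; rewrite /b ltnNge kj.
by case: k => //; rewrite big_geq ?mul0r.
Qed.

Hypothesis phi_mean : (gf_deriv1 phi < +oo)%E.

Lemma Phi_series_cvg : cvgn (series (fun n => fine (Phi phi n))).
Proof.
have f0 n : 0 <= fine (Phi phi n) by rewrite fine_ge0// Phi_ge0.
apply: nondecreasing_is_cvgn.
  by apply: nondecreasing_series => n _ _.
exists (fine (gf_deriv1 phi)) => _ [n _ <-].
have Phi1 : (\sum_(0 <= j <oo) Phi phi j = gf_deriv1 phi)%E.
  have := @Phi_weighted_sum (fun=> 1) (fun=> ler01).
  under eq_eseriesr do rewrite mul1e.
  move=> ->; apply: eq_eseriesr => k _.
  by rewrite sumr_const_nat subn0.
have d0 : (0 <= gf_deriv1 phi)%E.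
  by rewrite -Phi1; apply: nneseries_ge0 => j _ _; exact: Phi_ge0.
rewrite -lee_fin fineK ?ge0_fin_numE// -Phi1 seriesEnat /= -sumEFin.
under eq_bigr do rewrite fineK ?Phi_fin//.
by apply: nneseries_lim_ge => j _ _; exact: Phi_ge0.
Qed.

End Tails.

(** * From the normalized recurrence to ergodicity *)

Section Ergodicity.
Context {R : realType}.

(** Bridge from the real series, indexed from 0, to the extended sums of the definitions, indexed
    from 1. *)
Lemma eseries1_EFin (u : nat -> R) (l : R) : u 0%N = 0 ->
  series u @ \oo --> l -> (\sum_(1 <= i <oo) (u i)%:E = l%:E)%E.
Proof.
move=> u0 ul; apply/cvg_lim => //.
have -> : (fun n => \sum_(1 <= i < n) (u i)%:E)%E = EFin \o series u.
  apply/funext => -[|n]; rewrite /series/= sumEFin; first by rewrite !big_geq.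
  by rewrite [in RHS]big_ltn// u0 add0r.
by apply: cvg_EFin => //; exact: nearW.
Qed.

Lemma ergodic_of_unbounded (phi a : nat -> R) (lambda alpha mu : R) :
  proper_distribution phi -> (gf_deriv1 phi < +oo)%E ->
  (forall i, (0 < i)%N -> 0 < a i < 1) ->
  (forall C, exists N, C < series (Aprod a) N) ->
  0 < lambda -> 0 < alpha -> 0 < mu -> ergodic lambda alpha mu phi a.
Proof.
move=> phiP phi_mean a01 Aub l0 al0 m0.
pose f n := fine (Phi phi n).
have f_ge0 n : 0 <= f n by rewrite fine_ge0// Phi_ge0.
have /cvg_ex[U fU] := Phi_series_cvg phiP phi_mean.
have f0 : 0 < f 0%N by rewrite /f Phi0.
have fS n : phi n.+1 = f n - f n.+1.
  by rewrite /f (PhiS phiP n) fineD ?Phi_fin//= addrK.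
(* This is the consistency condition: the weighted total is then [alpha / (lambda c)], so that
   [K = alpha / (mu c)] after scaling by [lambda / mu]. *)
have [c c01 cU] : exists2 c, 0 < c < 1 &
    regime_total a f c = U + alpha / lambda.
  by apply: (regime_total_surj a01 f_ge0 fU) => //; rewrite ltrDl divr_gt0.
have /andP[c0 c1] := c01.
pose r n := lambda / mu * regime a f c n.
have r_ge0 n : 0 <= r n.
  by rewrite mulr_ge0 ?divr_ge0 ?regime_ge0// ltW.
have K : total_weight a r = (alpha / (mu * c))%:E.
  apply: eseries1_EFin; first by rewrite /r mulr0 mulr0.
  have -> : series (fun j => a j * r j) =
      (fun N => lambda / mu * series (fun n => a n * regime a f c n) N).
    apply/funext => N; rewrite /series/= mulr_sumr.
    by apply: eq_bigr => i _; rewrite /r mulrCA.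
  have -> : alpha / (mu * c) =
      lambda / mu * ((regime_total a f c - U) / c).
    by rewrite cU; field; rewrite !gt_eqF.
  by apply: cvgMr; exact: wregime_series_cvg.
have polE n : policy a r n = a n * r n / (alpha / (mu * c)).
  by case: n => [|n]; rewrite /policy ?K// /r mulr0 mulr0 mul0r.
exists r; split.
- split=> [i _|[//|n] _]; first exact: r_ge0.
  (* The drift is the difference of two consecutive recurrence relations, as
     [phi_(n+1) = Phi_n - Phi_(n+1)]. *)
  rewrite /drift !polE /r !regimeS fS /=.
  by field; rewrite !gt_eqF.
- rewrite (@eseries1_EFin r (lambda / mu * regime_total a f c)) ?ltry//.
    by rewrite /r mulr0.
  have -> : series r = (fun N => lambda / mu * series (regime a f c) N).
    by apply/funext => N; rewrite /series/= mulr_sumr.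
  by apply: cvgMr; apply: (regime_series_cvg a01 f_ge0 fU); rewrite ltW.
- have := @eseries1_EFin (policy a r) 1; apply=> //.
  have -> : series (policy a r) =
      (fun N => series (fun n => a n * regime a f c n) N
                * ((lambda / mu) / (alpha / (mu * c)))).
    apply/funext => N; rewrite /series/= mulr_suml.
    by apply: eq_bigr => i _; rewrite polE /r; ring.
  have -> : 1 = (regime_total a f c - U) / c
      * ((lambda / mu) / (alpha / (mu * c))).
    by rewrite cU; field; rewrite !gt_eqF.
  by apply: cvgMl; exact: wregime_series_cvg.
Qed.

End Ergodicity.

(** * Finiteness of the ergodicity bound *)

Section AprodRatio.
Context {R : realType}.
Variable a : nat -> R.
Hypothesis a01 : forall i, (0 < i)%N -> 0 < a i < 1.
Hypothesis a_incr : forall i j : nat, (0 < i)%N -> (i <= j)%N -> a i <= a j.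

Let a_gt0 i : (0 < i)%N -> 0 < a i.
Proof. by move=> /a01/andP[]. Qed.

Definition Aratio j k : R := Aprod a (j + k) / Aprod a j.

Lemma Aratio_ge0 j k : 0 <= Aratio j k.
Proof. by rewrite divr_ge0// ltW// Aprod_gt0. Qed.

Lemma Aratio0 j : Aratio j 0 = 1.
Proof. by rewrite /Aratio addn0 divff// gt_eqF// Aprod_gt0. Qed.

Lemma AratioS j k : Aratio j k.+1 = Aratio j k * a (j + k).+1.
Proof. by rewrite /Aratio addnS AprodS mulrAC. Qed.

Lemma Aratio_recl j k : Aratio j k.+1 = a j.+1 * Aratio j.+1 k.
Proof.
rewrite /Aratio addnS addSn !AprodS; field.
by rewrite !gt_eqF ?Aprod_gt0 ?a_gt0.
Qed.

Lemma Aratio_nondecreasing j k : Aratio j k <= Aratio j.+1 k.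
Proof.
elim: k => [|k ih]; first by rewrite !Aratio0.
rewrite !AratioS; apply: ler_pM => //; first exact: Aratio_ge0.
  exact/ltW/a_gt0.
by apply: a_incr => //; rewrite addSn.
Qed.

(** The truncation of [S_j] to [1 <= k <= n]: always finite, it allows induction on [n] before [S_j]
    is known to converge. *)
Definition Aratio_psum j n : R := \sum_(0 <= k < n) Aratio j k.+1.

Lemma Aratio_psum_recl j n :
  Aratio_psum j n.+1 = a j.+1 * (1 + Aratio_psum j.+1 n).
Proof.
rewrite /Aratio_psum big_nat_recl// Aratio_recl Aratio0 mulrDr; congr (_ + _).
by rewrite mulr_sumr; apply: eq_bigr => k _; rewrite Aratio_recl.
Qed.

Lemma Aratio_psum_nondecreasing n :
  {homo Aratio_psum^~ n : i j / (i <= j)%N >-> i <= j}.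
Proof.
apply: homo_leq => //; first exact: le_trans.
by move=> j; apply: ler_sum => k _; exact: Aratio_nondecreasing.
Qed.

(** Comparison principle: the empty sum is below [V], and each step of the recursion only calls a
    larger [j], so it never leaves the range [j >= J]. *)
Lemma Aratio_psum_le (V : nat -> R) J : (forall j, 0 <= V j) ->
  (forall j, (J <= j)%N -> a j.+1 * (1 + V j.+1) <= V j) ->
  forall n j, (J <= j)%N -> Aratio_psum j n <= V j.
Proof.
move=> V0 aV; elim=> [|n ih] j Jj; first by rewrite /Aratio_psum big_geq.
rewrite Aratio_psum_recl; apply: le_trans (aV _ Jj).
by rewrite ler_wpM2l ?(ltW (a_gt0 _))// lerD2l ih// leqW.
Qed.

(** With [q = a_(j+1)], monotonicity in [j] turns the recursion into [T_(n+1) >= q (1 + T_n)],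
    whence the geometric sum [q + ... + q^n], here cleared of its denominator. *)
Lemma Aratio_psum_ge j n :
  a j.+1 * (1 - a j.+1 ^+ n) <= Aratio_psum j n * (1 - a j.+1).
Proof.
have /andP[a0 a1] := a01 (ltn0Sn j); set q := a j.+1 in a0 a1 *.
elim: n => [|n ih]; first by rewrite expr0 subrr mulr0 /Aratio_psum big_geq ?mul0r.
have : Aratio_psum j n.+1 >= q * (1 + Aratio_psum j n).
  rewrite Aratio_psum_recl ler_pM2l// lerD2l.
  exact: Aratio_psum_nondecreasing.
have q1 : 0 < 1 - q by rewrite subr_gt0.
rewrite -(ler_pM2r q1); apply: le_trans.
rewrite exprS -mulrA ler_pM2l// mulrDl mul1r.
move: ih; lra.
Qed.

Definition Aratio_sum j : \bar R := (\sum_(0 <= k <oo) (Aratio j k.+1)%:E)%E.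

Lemma Aratio_sum_ge j : ((a j.+1 / (1 - a j.+1))%:E <= Aratio_sum j)%E.
Proof.
have /andP[a0 a1] := a01 (ltn0Sn j); set q := a j.+1 in a0 a1 *.
have q1 : 0 < 1 - q by rewrite subr_gt0.
have qn : (q * (1 - q ^+ n) / (1 - q))%:E @[n --> \oo] --> (q / (1 - q))%:E.
  apply: cvg_EFin; first exact: nearW.
  have -> : q / (1 - q) = q * (1 - 0) / (1 - q) by rewrite subr0 mulr1.
  apply: cvgMl; apply: cvgMr; apply: cvgB; first exact: cvg_cst.
  by apply: cvg_expr; rewrite gtr0_norm.
rewrite -(cvg_lim _ qn)//; apply: lime_le.
  by apply/cvg_ex; exists (q / (1 - q))%:E.
apply: nearW => n; apply: (@le_trans _ _ (Aratio_psum j n)%:E).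
  by rewrite lee_fin ler_pdivrMr// Aratio_psum_ge.
rewrite /Aratio_psum -sumEFin; apply: nneseries_lim_ge => k _ _.
by rewrite lee_fin Aratio_ge0.
Qed.

Lemma Aratio_sum_le j C : (forall n, Aratio_psum j n <= C) ->
  (Aratio_sum j <= C%:E)%E.
Proof.
move=> jC; apply: lime_le.
  by apply: is_cvg_nneseries => k _ _; rewrite lee_fin Aratio_ge0.
by apply: nearW => n; rewrite sumEFin lee_fin; exact: jC.
Qed.

Lemma Aratio_sum_le_powR (gamma nu B : R) : 0 < gamma -> 0 < nu -> 0 < B ->
  nu < 1 \/ nu = 1 /\ 1 < gamma -> weight_asymptotics a gamma nu B ->
  exists2 C : R, 0 < C &
    forall j, (Aratio_sum j <= (C * j.+1%:R `^ nu)%:E)%E.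
Proof.
move=> g0 nu0 B0 nuP aP.
have [C C0 [J _ aC]] := powR_supersolution g0 nu0 B0 nuP a01 aP.
have le_C := @Aratio_psum_le (fun j => C * j.+1%:R `^ nu) J.
have {}le_C n j : (J <= j)%N -> Aratio_psum j n <= C * j.+1%:R `^ nu.
  apply: le_C => [i|i Ji]; first by rewrite mulr_ge0 ?powR_ge0// ltW.
  exact/aC/leqW.
have ge1_powR j : 1 <= j.+1%:R `^ nu :> R.
  by rewrite -[leLHS](powRr0 j.+1%:R) ler_powR ?(ltW nu0)// ler1n.
(* Below [J], monotonicity gives [S_j <= S_J <= C (J+1)^nu], and the factor [(j+1)^nu >= 1] is
   harmless. *)
exists (C * J.+1%:R `^ nu); first by rewrite mulr_gt0// powR_gt0 ?ltr0n.
move=> j; apply: Aratio_sum_le => n; have [Jj|/ltnW jJ] := leqP J j.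
  apply: (le_trans (le_C _ _ Jj)); rewrite -mulrA ler_pM2l//.
  by rewrite ler_peMl ?powR_ge0.
apply: (le_trans (Aratio_psum_nondecreasing n jJ)).
apply: (le_trans (le_C _ _ (leqnn J))).
by rewrite ler_peMr// mulr_ge0 ?powR_ge0// ltW.
Qed.

(** The geometric bound gives [S_j >= a_1 / (1 - a_(j+1))], and [1 - a_(j+1)] is at most of order
    [(j+1)^(-nu)]. *)
Lemma Aratio_sum_ge_powR (gamma nu B : R) : 0 < gamma -> 0 < nu -> 0 < B ->
  weight_asymptotics a gamma nu B ->
  exists2 c : R, 0 < c &
    forall j, ((c * j.+1%:R `^ nu)%:E <= Aratio_sum j)%E.
Proof.
move=> g0 nu0 B0 [J _ aP].
have p0 n : 0 < n.+1%:R `^ nu :> R by rewrite powR_gt0 ?ltr0n.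
have [D D0 aD] : exists2 D, 0 < D & forall j, 1 - a j.+1 <= D / j.+1%:R `^ nu.
  (* [gamma + B] serves the indices covered by the expansion; [(J+1)^nu] serves the smaller ones,
     where only [1 - a_(j+1) <= 1] is used. *)
  exists (J.+1%:R `^ nu + gamma + B) => [|j]; first by rewrite !addr_gt0.
  have j1 : 1 <= j.+1%:R :> R by rewrite ler1n.
  have [Jj|jJ] := leqP J j.+1.
    have /aP/= /ler_normlP[+ _] := Jj.
    move: j1 (p0 j) (p0 J); move: (j.+1%:R `^ nu) (J.+1%:R `^ nu) => p q.
    move: (j.+1%:R : R) => x x1 p1 q0.
    have -> : B / (x * p) = B / p / x by rewrite invfM mulrA mulrAC.
    have : B / p / x <= B / p.
      by rewrite ler_pdivrMr ?(lt_le_trans _ x1)// ler_peMr// divr_ge0 ?ltW.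
    have : 0 <= q / p by rewrite divr_ge0 ?ltW.
    rewrite !mulrDl; lra.
  apply: (@le_trans _ _ 1); first by rewrite gerBl ltW// a_gt0.
  rewrite ler_pdivlMr// mul1r -addrA; apply: ler_wpDr.
    by rewrite addr_ge0 ?ltW.
  by rewrite ge0_ler_powR ?nnegrE ?(ltW nu0)// ler_nat ltnW// ltnW.
exists (a 1%N / D) => [|j]; first by rewrite divr_gt0 ?a_gt0.
apply: le_trans (Aratio_sum_ge j); rewrite lee_fin.
have /andP[aj0 aj1] := a01 (ltn0Sn j).
have aj : 0 < 1 - a j.+1 by rewrite subr_gt0.
rewrite ler_pdivlMr//; apply: (@le_trans _ _ (a 1%N)); last exact: a_incr.
have := aD j; rewrite ler_pdivlMr// => aDj.
by rewrite -(mulrA (_ / _)) mulrAC ler_pdivrMr// ler_pM2l ?a_gt0// mulrC.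
Qed.

End AprodRatio.

(** * Moments of the distribution and finiteness of the bound *)

Section Moments.
Context {R : realType}.
Variable phi : nat -> R.
Implicit Types (a : nat -> R) (nu c C : R).
Hypothesis phi_distr : proper_distribution phi.

Lemma sum_powR_le nu k : 0 <= nu ->
  \sum_(0 <= j < k) j.+1%:R `^ nu <= k%:R `^ (nu + 1) :> R.
Proof.
move=> nu0; case: k => [|k]; first by rewrite big_geq// powR_ge0.
rewrite powRD ?pnatr_eq0 ?implybT// powRr1// mulr_natr.
apply: (@le_trans _ _ (\sum_(0 <= j < k.+1) k.+1%:R `^ nu)).
  rewrite big_nat [leRHS]big_nat; apply: ler_sum => j /andP[_ jk].
  by rewrite ge0_ler_powR ?nnegrE// ler_nat.
by rewrite sumr_const_nat subn0.
Qed.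

(** By induction, the increment of [k^(nu+1)] is at most [2 (k+1)^nu]. For [x = k >= 1] this follows
    from [(x - 1) (x + 1)^nu <= x^(nu+1)]; [k = 0] is treated apart. *)
Lemma sum_powR_ge nu k : 0 < nu -> nu <= 1 ->
  k%:R `^ (nu + 1) <= 2 * \sum_(0 <= j < k) j.+1%:R `^ nu :> R.
Proof.
move=> nu0 nu1; have nu2 : nu + 1 != 0 by rewrite gt_eqF// addr_gt0.
elim: k => [|k ih]; first by rewrite big_geq// mulr0 powR0.
rewrite big_nat_recr//= mulrDr.
suff : k.+1%:R `^ (nu + 1) <= k%:R `^ (nu + 1) + 2 * k.+1%:R `^ nu :> R.
  by move: ih; lra.
have powRS n : n.+1%:R `^ (nu + 1) = n.+1%:R * n.+1%:R `^ nu :> R.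
  by rewrite powRD ?pnatr_eq0 ?implybT// powRr1// mulrC.
case: k {ih} => [|k]; first by rewrite powR0// powR1 add0r; lra.
rewrite !powRS -[k.+2%:R]natr1; set x : R := k.+1%:R.
have x0 : 0 < x by rewrite ltr0n.
have := powR_succ_le x0 nu1; set p := (x + 1) `^ nu => ple.
have : (x - 1) * p <= (x - 1) * (x `^ nu * (1 + x^-1)).
  by rewrite ler_wpM2l// subr_ge0 ler1n.
have -> : (x - 1) * (x `^ nu * (1 + x^-1)) = x * x `^ nu - x `^ nu / x.
  by field; rewrite gt_eqF.
have : 0 <= x `^ nu / x by rewrite divr_ge0 ?powR_ge0// ltW.
rewrite mulrBl mulrDl !mul1r; move: (_ / _) (x * _) (x * p) => u v w; lra.
Qed.

(** After exchanging sums, the coefficient of [phi_k] lies between [k^(nu+1) / 2] and [k^(nu+1)]. *)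
Lemma moment_equiv nu : 0 < nu -> nu <= 1 ->
  (\sum_(0 <= j <oo) (j.+1%:R `^ nu)%:E * Phi phi j < +oo)%E <->
  (\sum_(1 <= j <oo) (j%:R `^ (nu + 1) * phi j)%:E < +oo)%E.
Proof.
move=> nu0 nu1; rewrite Phi_weighted_sum//.
have phi0 k : (0 < k)%N -> 0 <= phi k by case: phi_distr => + _; exact.
have w0 k : 0 <= \sum_(0 <= j < k) j.+1%:R `^ nu :> R.
  by apply: sumr_ge0 => j _; exact: powR_ge0.
rewrite !(eseries_cond _ xpredT 1)/=; split => [fin|]; last first.
  apply: le_lt_trans; apply: lee_nneseries => k.
    by move=> _ k0; rewrite lee_fin mulr_ge0 ?phi0.
  by move=> k0; rewrite lee_fin ler_wpM2r ?phi0// sum_powR_le// ltW.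
apply: (@le_lt_trans _ _ (\sum_(k <oo | (0 < k)%N)
    2%:E * ((\sum_(0 <= j < k) j.+1%:R `^ nu) * phi k)%:E)%E).
  apply: lee_nneseries => k.
    by move=> _ k0; rewrite lee_fin mulr_ge0 ?phi0 ?powR_ge0.
  by move=> k0; rewrite -EFinM lee_fin mulrA ler_wpM2r ?phi0// sum_powR_ge.
rewrite nneseriesZl; last by move=> k k0; rewrite lee_fin mulr_ge0 ?phi0.
by rewrite lte_mul_pinfty.
Qed.

Lemma ergodicity_bound_sum a : (forall i, (0 < i)%N -> 0 < a i) ->
  ergodicity_bound phi a = (\sum_(0 <= j <oo) Aratio_sum a j * Phi phi j)%E.
Proof.
move=> a0; rewrite ergodicity_boundE//; last by move=> i i0; rewrite ltW ?a0.
have r0 j k : (0 <= (Aratio a j k)%:E)%E.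
  by rewrite lee_fin divr_ge0// ltW// Aprod_gt0.
have P0 := Phi_ge0 phi_distr.
rewrite -nneseries_addn; last first.
  by move=> k; apply: nneseries_ge0 => j _ _; exact: (mule_ge0 (r0 _ _) (P0 _)).
rewrite nneseries_interchange; last by move=> k j; exact: (mule_ge0 (r0 _ _) (P0 _)).
apply: eq_eseriesr => j _.
(* [Phi_j] is finite, hence can be moved through the sum over [k] as a real scalar. *)
rewrite -(fineK (Phi_fin phi_distr j)) muleC -nneseriesZl//.
by apply: eq_eseriesr => k _; rewrite muleC addn1.
Qed.

Lemma ergodicity_bound_finite a nu c C : 0 < c -> 0 < C ->
  (forall i, (0 < i)%N -> 0 < a i) ->
  (forall j, ((c * j.+1%:R `^ nu)%:E <= Aratio_sum a j)%E) ->
  (forall j, (Aratio_sum a j <= (C * j.+1%:R `^ nu)%:E)%E) ->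
  (ergodicity_bound phi a < +oo)%E <->
  (\sum_(0 <= j <oo) (j.+1%:R `^ nu)%:E * Phi phi j < +oo)%E.
Proof.
move=> c0 C0 a0 ge_c le_C; rewrite ergodicity_bound_sum//.
have P0 := Phi_ge0 phi_distr.
have w0 j : (0 <= (j.+1%:R `^ nu)%:E * Phi phi j)%E.
  by rewrite mule_ge0// lee_fin powR_ge0.
have S0 j : (0 <= Aratio_sum a j)%E.
  by apply: le_trans (ge_c j); rewrite lee_fin mulr_ge0 ?powR_ge0// ltW.
split=> fin; last first.
  apply: (@le_lt_trans _ _
    (C%:E * \sum_(0 <= j <oo) (j.+1%:R `^ nu)%:E * Phi phi j)%E).
    rewrite -nneseriesZl//; apply: lee_nneseries => j _; first by rewrite mule_ge0.
    by rewrite muleA -EFinM lee_wpmul2r.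
  by apply: lte_mul_pinfty => //; rewrite lee_fin ltW.
apply: (@le_lt_trans _ _
  (c^-1%:E * \sum_(0 <= j <oo) Aratio_sum a j * Phi phi j)%E).
  rewrite -nneseriesZl// => [|j _]; last by rewrite mule_ge0.
  apply: lee_nneseries => j _ //; rewrite muleA lee_wpmul2r//.
  apply: le_trans (lee_wpmul2l _ (ge_c j)).
    by rewrite -EFinM mulKf// gt_eqF.
  by rewrite lee_fin invr_ge0 ltW.
by apply: lte_mul_pinfty => //; rewrite lee_fin invr_ge0 ltW.
Qed.

End Moments.

Unset Implicit Arguments.
Local Open Scope ereal_scope.

Theorem proposition3p4 (R : realType) (phi a : nat -> R) (gamma nu : R)
  (phi_distr : proper_distribution phi)
  (phi_mean : gf_deriv1 phi < +oo)
  (gamma_gt0 : (0 < gamma)%R)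
  (nu_gt0 : (0 < nu)%R)
  (a1_gt0 : (0 < a 1%N)%R)
  (a_incr : forall i j : nat, (0 < i)%N -> (i <= j)%N -> (a i <= a j)%R)
  (a_asymp : a = (fun i : nat => (1 - gamma * i%:R `^ (- nu))%R)
                 +O_\oo (fun i : nat => (i%:R `^ (- nu - 1))%R)) :
  ((1 < nu)%R \/ nu = 1%R /\ (gamma <= 1)%R ->
    forall lambda alpha mu : R,
      (0 < lambda)%R -> (0 < alpha)%R -> (0 < mu)%R ->
      ergodic lambda alpha mu phi a) /\
  ((nu < 1)%R \/ nu = 1%R /\ (1 < gamma)%R ->
    (ergodicity_bound phi a < +oo <->
     \sum_(1 <= j <oo) (j%:R `^ (nu + 1) * phi j)%:E < +oo)).
Proof.
have [B B0 aP] := bigO_weight_asymptotics a_asymp.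
have a01 i : (0 < i)%N -> (0 < a i < 1)%R.
  move=> i0; rewrite (lt_le_trans a1_gt0) ?a_incr//=.
  exact: (weights_lt1 a_incr _ _ aP).
have a0 i : (0 < i)%N -> (0 < a i)%R by move=> /a01/andP[].
split=> nuP.
  move=> lambda alpha mu; apply: ergodic_of_unbounded => // C.
  exact: Aprod_series_unbounded a0 B0 (weights_ge gamma_gt0 B0 nuP aP).
have nu1 : (nu <= 1)%R by case: nuP => [/ltW|[->]].
have [c c0 cP] := Aratio_sum_ge_powR a01 a_incr gamma_gt0 nu_gt0 B0 aP.
have [C C0 CP] := Aratio_sum_le_powR a01 a_incr gamma_gt0 nu_gt0 B0 nuP aP.
apply: iff_trans (moment_equiv phi_distr nu_gt0 nu1).
exact: (ergodicity_bound_finite phi_distr c0 C0 a0 cP CP).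
Qed.
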